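(* Let $N \ge 1$, let $G_N$ be the divisibility graph on $X_N=\{1,\dots,N\}$, and let $n \in X_N$ have degree $k_n$. Then the mean geodesic distance of $n$ is $$l_n = \frac{2N - k_n - 2}{N}.$$
   Context: The divisibility graph $G_N$ is the simple undirected graph with vertex set $X_N=\{1,\dots,N\}$, in which two distinct vertices $i \ne j$ are adjacent if and only if $i$ divides $j$ or $j$ divides $i$ (no loops). The degree $k_n$ is the number of vertices adjacent to $n$. For vertices $n,m$, $d_{nm}$ is the length of a shortest path between $n$ and $m$ (so $d_{nn}=0$). The mean geodesic distance of $n$ is $l_n = \frac{1}{N}\sum_{m \in X_N} d_{nm}$. *)

(* Defs.v *)
From mathcomp Require Import all_boot all_order all_algebra.
Set Implicit Arguments.
Unset Strict Implicit.
Unset Printing Implicit Defensive.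
Import GRing.Theory.

Local Open Scope nat_scope.

Section Graph.
Variables (T : finType) (e : rel T).

Definition degree (x : T) : nat := #|[set y | e x y]|.

Definition has_walk (x y : T) (k : nat) : bool :=
  [exists p : k.-tuple T, path e x p && (last x p == y)].

(* A shortest path visits each vertex at most once, so its length is below
   #|T|; the search up to #|T| therefore finds it, as [geodesicP] states.
   The value is #|T| when x and y are not connected. *)
Definition geodesic (x y : T) : nat := find (has_walk x y) (iota 0 #|T|).

Lemma has_walkP x y k :
  reflect (exists p, [/\ path e x p, last x p = y & size p = k])
          (has_walk x y k).
Proof.
apply: (iffP existsP) => [[p /andP[xp /eqP py]]|[p [xp py /eqP sz]]].
  by exists p; rewrite size_tuple.
by exists (Tuple sz); rewrite /= xp py eqxx.
Qed.

Lemma geodesicP x y : connect e x y ->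
  (exists p, [/\ path e x p, last x p = y & size p = geodesic x y]) /\
  (forall p, path e x p -> last x p = y -> geodesic x y <= size p).
Proof.
case/connectP=> p0 /shortenP[p xp Up _] -> {p0}.
set z := last x p.
have szp : size p < #|T| by have := card_uniqP Up => /= <-; exact: max_card.
have Hp : has (has_walk x z) (iota 0 #|T|).
  apply/hasP; exists (size p); first by rewrite mem_iota.
  by apply/has_walkP; exists p.
have lt_g : geodesic x z < #|T| by move: Hp; rewrite has_find size_iota.
split.
  by have := nth_find 0 Hp; rewrite nth_iota // add0n => /has_walkP.
move=> q xq qz; rewrite leqNgt; apply/negP => lt_q.
have := before_find 0 lt_q; rewrite nth_iota ?(ltn_trans lt_q) // add0n.
by move/negbT/negP; apply; apply/has_walkP; exists q.
Qed.

End Graph.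

(* The index i : 'I_N stands for the vertex i.+1 of {1, ..., N}. *)
Definition vertex (N : nat) (i : 'I_N) : nat := i.+1.

Definition divgraph (N : nat) : rel 'I_N :=
  fun i j => (i != j) && ((vertex i %| vertex j) || (vertex j %| vertex i)).

Definition mean_geodesic (N : nat) (n : 'I_N) : rat :=
  (N%:R^-1 * \sum_(m < N) (geodesic (@divgraph N) n m)%:R)%R.

(* Main.v *)
Require Import Defs.
From mathcomp Require Import all_boot all_order all_algebra.
From mathcomp Require Import ring.
Import GRing.Theory.

(** The vertex 1 is adjacent to every other vertex, so the distance from n to m
is 0 if m = n, 1 if m is a neighbour of n, and 2 otherwise; that is, it is 2,
minus 1 for an edge, minus 2 for equality.  Now sum over m. *)

Lemma geodesic_hub (T : finType) (e : rel T) (h x y : T) :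
  irreflexive e -> (forall z, z != h -> e z h && e h z) ->
  geodesic e x y + e x y + (x == y).*2 = 2.
Proof.
move=> irr_e hub.
have [<-|neq_xy] := eqVneq x y.
  have [_ /(_ [::] isT erefl)] := @geodesicP T e x x (connect0 e x).
  by rewrite leqn0 irr_e => /eqP->.
have [exy|nexy] := boolP (e x y).
  (* The edge itself bounds the distance by 1; length 0 would force [x = y]. *)
  have [[p [_ px <-]] /(_ [:: y])] := geodesicP (connect1 exy).
  rewrite /= exy => /(_ isT erefl); case: p px => [|? [|]] //= eq_xy.
  by rewrite eq_xy eqxx in neq_xy.
(* The hub is adjacent to every other vertex, so two distinct non-adjacent vertices both differ from
   it and are joined through it. *)
have x_h : x != h.
  apply: contraNneq nexy => x_h.
  by move: neq_xy; rewrite x_h eq_sym => /hub/andP[].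
have y_h : y != h.
  by apply: contraNneq nexy => ->; have /andP[] := hub x x_h.
have xhy : path e x [:: h; y].
  by move/andP: (hub x x_h) => /= [-> _]; move/andP: (hub y y_h) => [_ ->].
have cxy : connect e x y by apply/connectP; exists [:: h; y].
have [[p [xp px <-]] /(_ [:: h; y] xhy erefl)] := geodesicP cxy.
(* A shortest path of length 0 would give [x = y], one of length 1 an edge; only length 2
   remains. *)
case: p xp px => [|z [|? [|]]] //= xp px.
  by rewrite px eqxx in neq_xy.
by move: xp nexy; rewrite px andbT => ->.
Qed.

Lemma sum_geodesic_hub (T : finType) (e : rel T) (h x : T) :
  irreflexive e -> (forall z, z != h -> e z h && e h z) ->
  \sum_y geodesic e x y + degree e x + 2 = 2 * #|T|.
Proof.
move=> irr_e hub; rewrite mulnC -sum_nat_const.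
under [RHS]eq_bigr => y _ do rewrite -(geodesic_hub T e h x y irr_e hub).
rewrite !big_split /= /degree cardsE -sum1_card.
congr (_ + _ + _).
  (* The edge indicators sum to the degree. *)
  by rewrite big_mkcond; apply: eq_bigr => y _; rewrite unfold_in; case: (e x y).
(* Only [y = x] contributes here, giving the 2. *)
by rewrite (bigD1 x) //= eqxx big1 // => y; rewrite eq_sym => /negPf->.
Qed.

Lemma divgraph_irr N : irreflexive (@divgraph N).
Proof. by move=> i; rewrite /divgraph eqxx. Qed.

(** Index 0 stands for the vertex 1, which divides every vertex. *)
Lemma divgraph_hub N (h : 'I_N) : h = 0 :> nat ->
  forall z, z != h -> divgraph z h && divgraph h z.
Proof.
by move=> h0 z z_h; rewrite /divgraph /vertex h0 !dvd1n orbT z_h eq_sym z_h.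
Qed.

Theorem theorem3 (N : nat) (n : 'I_N) :
  (1 <= N)%N ->
  mean_geodesic n =
    ((2 * N%:R - (degree (@divgraph N) n)%:R - 2) / N%:R)%R.
Proof.
move=> N_gt0; rewrite /mean_geodesic -natr_sum mulrC; congr (_ / _)%R.
have := sum_geodesic_hub _ _ _ n (divgraph_irr N)
  (divgraph_hub N (Ordinal N_gt0) erefl).
(* The additive identity on [nat] is cast to [rat], where subtraction does not truncate. *)
rewrite card_ord => /(congr1 (fun k => k%:R : rat)%R).
rewrite natrM !natrD => <-; ring.
Qed.
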